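(* Let $N$ and $N'$ be graded submodules of a $G$-graded $R$-module $M$ and let $I$ be a graded ideal of $R$. Then the following hold: (1) $V_G(N)=\nu_G(N)\cap Spec_G(M)$. (2) $V^*_G(N)=\nu^*_G(N)\cap Spec_G(M)$. (3) If $Gr((N:_R M))=Gr((N':_R M))$, then $\nu_G(N)=\nu_G(N')$. The converse is also true if $N,N'\in\mathcal{PS}_G(M)$. (4) $\nu_G(N)=\nu_G((N:_R M)M)=\nu^*_G((N:_R M)M)=\nu^*_G(Gr((N:_R M))M)$. In particular, $\nu^*_G(IM)=\nu_G(IM)$.
   Context: $G$ is a multiplicative group, $R=\bigoplus_{g\in G}R_g$ is a commutative $G$-graded ring with identity ($R_gR_h\subseteq R_{gh}$), and $M=\bigoplus_{g\in G}M_g$ is a $G$-graded $R$-module ($R_gM_h\subseteq M_{gh}$). $h(R)=\bigcup_g R_g$ and $h(M)=\bigcup_g M_g$ are the sets of homogeneous elements. An ideal $I$ is graded if $I=\bigoplus_g(I\cap R_g)$; a submodule $N$ is graded if $N=\bigoplus_g(N\cap M_g)$. For a graded submodule $N$, $(N:_R M)=\{r\in R: rM\subseteq N\}$, a graded ideal of $R$. For a graded ideal $I$, the graded radical $Gr(I)$ is the set of all $a=\sum_g a_g\in R$ such that for each $g$ there is $n_g>0$ with $a_g^{n_g}\in I$. A proper graded submodule $P$ of $M$ is graded prime if for $r\in h(R)$, $m\in h(M)$, $rm\in P$ implies $m\in P$ or $r\in(P:_R M)$. $Spec_G(M)$ is the set of graded prime submodules of $M$. A proper graded submodule $Q$ is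 graded primary if for $r\in h(R)$, $m\in h(M)$, $rm\in Q$ implies $m\in Q$ or $r\in Gr((Q:_R M))$. For a graded submodule $N$, $Gr_M(N)$ is the intersection of all graded prime submodules of $M$ containing $N$, with $Gr_M(N)=M$ if there are none. The graded primary spectrum $\mathcal{PS}_G(M)$ is the set of all graded primary submodules $Q$ of $M$ with $(Gr_M(Q):_R M)=Gr((Q:_R M))$; one has $Spec_G(M)\subseteq\mathcal{PS}_G(M)$. For a graded submodule $N$ of $M$: $\nu_G(N)=\{Q\in\mathcal{PS}_G(M): (N:_R M)\subseteq(Gr_M(Q):_R M)\}$, $\nu^*_G(N)=\{Q\in\mathcal{PS}_G(M): N\subseteq Gr_M(Q)\}$, $V_G(N)=\{P\in Spec_G(M): (N:_R M)\subseteq(P:_R M)\}$, $V^*_G(N)=\{P\in Spec_G(M): N\subseteq P\}$. Standing assumption: $Spec_G(M)$ and $\mathcal{PS}_G(M)$ are non-empty. *)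

(* Defs.v *)
From HB Require Import structures.
From mathcomp Require Import all_boot all_algebra.
From mathcomp Require Import mathcomp_extra boolp classical_sets functions.
From mathcomp Require Import cardinality fsbigop.

Set Implicit Arguments.
Unset Strict Implicit.
Unset Printing Implicit Defensive.

Import GRing.Theory.

Local Open Scope classical_set_scope.
Local Open Scope ring_scope.

Section DirectSum.
Context {G : groupType} {V : zmodType}.
Implicit Types (A : G -> set V) (S : set V) (x : V) (f : G -> V).

(* [f] is the family of components of [x] relative to the subsets [A g].
   Finiteness of the support is required because the sum over [[set: G]] is by
   convention [0] when the support is infinite. *)
Definition decomposition A x f : Prop :=
  [/\ forall g, A g (f g),
      finite_set [set g | f g <> 0]
    & x = \sum_(g \in [set: G]) f g].

Definition direct_sum A S : Prop :=
  [/\ forall g, zmod_closed (mem (A g)),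
      forall x f, decomposition A x f -> S x
    & forall x, S x -> exists! f, decomposition A x f].

Definition homogeneous A : set V := \bigcup_g A g.

End DirectSum.

Definition graded_ring (G : groupType) (R : comPzRingType) (Rg : G -> set R)
    : Prop :=
  direct_sum Rg [set: R] /\
  forall (g h : G) (a b : R), Rg g a -> Rg h b -> Rg (g * h)%g (a * b).

Definition graded_module (G : groupType) (R : comPzRingType) (M : lmodType R)
    (Rg : G -> set R) (Mg : G -> set M) : Prop :=
  direct_sum Mg [set: M] /\
  forall (g h : G) (a : R) (m : M), Rg g a -> Mg h m -> Mg (g * h)%g (a *: m).

Definition graded_submodule (G : groupType) (R : comPzRingType)
    (M : lmodType R) (Mg : G -> set M) (N : set M) : Prop :=
  submod_closed (mem N) /\ direct_sum (fun g => N `&` Mg g) N.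

(* Ideals of [R], not necessarily proper, are the submodules of [R^o]. *)
Definition graded_ideal (G : groupType) (R : comPzRingType)
    (Rg : G -> set R) (I : set R) : Prop :=
  @graded_submodule G R R^o Rg I.

Definition residual (R : comPzRingType) (M : lmodType R) (N : set M) : set R :=
  [set r | forall m : M, N (r *: m)].

Definition ideal_smul (R : comPzRingType) (M : lmodType R) (I : set R)
    : set M :=
  [set x | exists (n : nat) (a : 'I_n -> R) (m : 'I_n -> M),
     (forall i, I (a i)) /\ x = \sum_(i < n) a i *: m i].
Arguments ideal_smul {R} M I.

Definition graded_radical (G : groupType) (R : comPzRingType)
    (Rg : G -> set R) (I : set R) : set R :=
  [set a | exists2 f : G -> R, decomposition Rg a f &
     forall g, exists2 n : nat, (0 < n)%N & I (f g ^+ n)].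

Section Spectra.
Context {G : groupType} {R : comPzRingType} {M : lmodType R}.
Variables (Rg : G -> set R) (Mg : G -> set M).
Implicit Types N P Q : set M.

Definition graded_prime P : Prop :=
  [/\ graded_submodule Mg P, P <> [set: M]
    & forall r m, homogeneous Rg r -> homogeneous Mg m ->
        P (r *: m) -> P m \/ residual P r].

Definition graded_primary Q : Prop :=
  [/\ graded_submodule Mg Q, Q <> [set: M]
    & forall r m, homogeneous Rg r -> homogeneous Mg m ->
        Q (r *: m) -> Q m \/ graded_radical Rg (residual Q) r].

Definition graded_spec : set (set M) := [set P | graded_prime P].

(* When no graded prime contains [N], this empty intersection is [[set: M]]. *)
Definition graded_module_radical N : set M :=
  \bigcap_(P in [set P | graded_spec P /\ N `<=` P]) P.

Definition graded_primary_spec : set (set M) :=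
  [set Q | graded_primary Q /\
     residual (graded_module_radical Q) = graded_radical Rg (residual Q)].

Definition nuG N : set (set M) :=
  [set Q | graded_primary_spec Q /\
     residual N `<=` residual (graded_module_radical Q)].

Definition nuG_star N : set (set M) :=
  [set Q | graded_primary_spec Q /\ N `<=` graded_module_radical Q].

Definition VG N : set (set M) :=
  [set P | graded_spec P /\ residual N `<=` residual P].

Definition VG_star N : set (set M) :=
  [set P | graded_spec P /\ N `<=` P].

End Spectra.

(* Main.v *)
(** The point is that a graded prime [P] satisfies
    [Gr(P : M) = (P : M)]: if a power of a homogeneous [r] sends [M] into [P],
    then peeling off one factor [r] at a time gives [r \in (P : M)].
    Intersecting over graded primes, [(Gr_M(Q) : M)] equals its own graded
    radical for every [Q]; hence a graded ideal [J] lies in [(Gr_M(Q) : M)]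
    iff [Gr(J)] does. Together with [J M `<=` S <-> J `<=` (S : M)] for a
    submodule [S], everything follows. *)
Require Import Defs.
From mathcomp Require Import all_boot all_algebra.
From mathcomp Require Import boolp classical_sets.
From mathcomp Require Import finmap functions cardinality fsbigop.

Set Implicit Arguments.
Unset Strict Implicit.
Unset Printing Implicit Defensive.

Import GRing.Theory.

Local Open Scope classical_set_scope.
Local Open Scope ring_scope.

(** * Submodules, residuals and products [I M] *)

Section Submodules.
Context {R : comPzRingType} {M : lmodType R}.
Implicit Types (S N : set M) (I J : set R).

Lemma submod_mem0 S : submod_closed (mem S) -> S 0.
Proof. by case; rewrite in_setE. Qed.

Lemma submod_memD S x y : submod_closed (mem S) -> S x -> S y -> S (x + y).
Proof.
case=> _ Slin Sx Sy; rewrite -[x]scale1r -in_setE.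
by apply: Slin; rewrite in_setE.
Qed.

Lemma submod_memZ S a x : submod_closed (mem S) -> S x -> S (a *: x).
Proof.
move=> Ssub Sx; rewrite -[_ *: _]addr0 -in_setE.
by case: Ssub => S0; apply => //; rewrite in_setE.
Qed.

Lemma submod_sum S (T : Type) (s : seq T) (f : T -> M) :
  submod_closed (mem S) -> (forall i, S (f i)) -> S (\sum_(i <- s) f i).
Proof.
move=> Ssub Sf; apply: big_ind => //; first exact: submod_mem0.
by move=> x y; apply: submod_memD.
Qed.

Lemma residual_sum S (T : Type) (s : seq T) (f : T -> R) :
  submod_closed (mem S) -> (forall i, residual S (f i)) ->
  residual S (\sum_(i <- s) f i).
Proof.
by move=> Ssub Sf m; rewrite scaler_suml; apply: submod_sum => // i; apply: Sf.
Qed.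

Lemma ideal_smul_subset S I : submod_closed (mem S) ->
  (ideal_smul M I `<=` S) = (I `<=` residual S).
Proof.
move=> Ssub; apply/propext; split=> [IMS a Ia m | IS _ [n [a [m [Ia ->]]]]].
  apply: IMS; exists 1%N, (fun=> a), (fun=> m).
  by split=> //; rewrite big_ord1.
by apply: submod_sum => // i; apply: IS.
Qed.

Lemma residual_mono S N : S `<=` N -> residual S `<=` residual N.
Proof. by move=> SN r Sr m; apply: SN. Qed.

Lemma subset_residual_smul I : I `<=` residual (ideal_smul M I).
Proof.
move=> a Ia m; exists 1%N, (fun=> a), (fun=> m).
by split=> //; rewrite big_ord1.
Qed.

(** The closure identity of the adjunction between [ideal_smul M] and [residual]: its counit is
    [(N : M) M] inside [N], its unit is [subset_residual_smul]. *)
Lemma residual_smul_residual N : submod_closed (mem N) ->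
  residual (ideal_smul M (residual N)) = residual N.
Proof.
move=> Nsub; apply/seteqP; split; last exact: subset_residual_smul.
by apply: residual_mono; rewrite ideal_smul_subset.
Qed.

End Submodules.

(** * Homogeneous components of elements and residuals *)

Section Graded.
Context {G : groupType} {R : comPzRingType} {M : lmodType R}.
Variables (Rg : G -> set R) (Mg : G -> set M).
Implicit Types (N P Q S : set M) (I J : set R).

(** Multiplying by [m] of degree [h] sends degree [g] to [g * h], a bijection of [G]. Hence the
    component of degree [k] comes from degree [k * h^-1]; [G] may be noncommutative, so the side
    matters. *)
Lemma decomposition_scale r f h m : graded_module Rg Mg ->
  decomposition Rg r f -> Mg h m ->
  decomposition Mg (r *: m) (fun k => f (k * h^-1)%g *: m).
Proof.
move=> [_ gradZ] [Rf fin_f ->] Mm; split.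
- by move=> k; rewrite -{1}[k](mulgVK h); apply: gradZ.
- apply: (sub_finite_set _ (finite_image (fun g => (g * h)%g) fin_f)).
  move=> k /= fkm; exists (k * h^-1)%g; last by rewrite mulgVK.
  by move=> fk; apply: fkm; rewrite fk scale0r.
rewrite [RHS](@reindex_fsbigT _ _ _ _ _ (fun g : G => (g * h)%g)); last first.
  by exists (fun g => (g * h^-1)%g) => g; rewrite ?mulgK ?mulgVK.
rewrite (eq_fsbigr (fun g => f g *: m)); last by move=> g _; rewrite mulgK.
(* Both sums are cut down to the support of [f], which may exceed that of [f g *: m], so that finite
   distributivity applies. *)
have f0 g : g \notin fset_set [set g | f g <> 0] -> f g = 0.
  by rewrite in_fset_set // notin_setE /= => /contrapT.
rewrite (fsbigTE _ _ f0) (fsbigTE (fset_set [set g | f g <> 0])).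
  by rewrite scaler_suml.
by move=> g /f0 ->; rewrite scale0r.
Qed.

(** A decomposition of [x] inside [N] is also one inside [M], so uniqueness in [M] identifies it
    with [f]. *)
Lemma graded_submodule_component N x f g : graded_module Rg Mg ->
  graded_submodule Mg N -> decomposition Mg x f -> N x -> N (f g).
Proof.
move=> [[_ _ Mdec] _] [_ [_ _ Ndec]] xf Nx.
have [f' [[Nf' fin_f' xE] _]] := Ndec _ Nx.
have [f'' [_ uniq_f]] := Mdec x I.
have <- : f' = f; last by case: (Nf' g).
rewrite -(uniq_f _ xf); apply/esym/uniq_f.
by split=> // k; case: (Nf' k).
Qed.

Lemma residual_homogeneous N r : graded_module Rg Mg ->
  submod_closed (mem N) ->
  (forall m, homogeneous Mg m -> N (r *: m)) -> residual N r.
Proof.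
move=> [[_ _ Mdec] _] Nsub Nr m.
have [f [[Mf _ ->] _]] := Mdec m I.
rewrite scaler_sumr; apply: submod_sum => // g.
by apply: Nr; exists g.
Qed.

Lemma residual_component N r f g : graded_module Rg Mg ->
  graded_submodule Mg N -> decomposition Rg r f -> residual N r ->
  residual N (f g).
Proof.
move=> gradM gradN rf Nr; apply: residual_homogeneous => //.
  by case: gradN.
(* This exhibits [f g *: m] as the component of [r *: m] in degree [g * h]. *)
move=> m [h _ Mm]; rewrite -[g](mulgK h).
exact: (graded_submodule_component _ gradM gradN
          (decomposition_scale gradM rf Mm) (Nr m)).
Qed.

(** * Graded radicals and graded primes *)

Lemma graded_radical_mono I J :
  I `<=` J -> graded_radical Rg I `<=` graded_radical Rg J.
Proof.
by move=> IJ a [f af fI]; exists f => // g; have [n n0 /IJ] := fI g; exists n.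
Qed.

Lemma residual_subset_radical N : graded_ring Rg -> graded_module Rg Mg ->
  graded_submodule Mg N -> residual N `<=` graded_radical Rg (residual N).
Proof.
move=> [[_ _ Rdec] _] gradM gradN r Nr; have [f [rf _]] := Rdec r I.
exists f => // g; exists 1%N => //.
by rewrite expr1; apply: residual_component rf Nr.
Qed.

Lemma graded_prime_residual_exp P r n : graded_module Rg Mg ->
  graded_prime Rg Mg P -> homogeneous Rg r -> residual P (r ^+ n) ->
  residual P r.
Proof.
move=> gradM [[Psub _] P_proper Pprime] hr Prn.
(* If [r] is outside [(P : M)], primeness cancels [r] from any homogeneous multiple in [P].
   Cancelling all [n] factors puts every homogeneous [m] in [P], against properness; this covers
   [n = 0] too. *)
have [//|Pr] := pselect (residual P r); case: P_proper.
suff Phom m : homogeneous Mg m -> P m.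
  apply/seteqP; split=> // x _; rewrite -[x]scale1r.
  by apply: residual_homogeneous => // m; rewrite scale1r; apply: Phom.
have: P (r ^+ n *: m) by exact: Prn.
elim: n m {Prn} => [|n IHn] m; first by rewrite expr0 scale1r.
rewrite exprSr -scalerA => Prm hm.
suff: P (r *: m) by move=> /(Pprime _ _ hr hm) [].
apply: IHn Prm _; case: hr hm => [g _ Rr] [h _ Mm].
by exists (g * h)%g => //; case: gradM => _; apply.
Qed.

Lemma graded_prime_radical P : graded_ring Rg -> graded_module Rg Mg ->
  graded_prime Rg Mg P -> graded_radical Rg (residual P) = residual P.
Proof.
move=> gradR gradM Pprime; have [gradP _ _] := Pprime.
apply/seteqP; split; last exact: residual_subset_radical.
move=> a [f [Rf _ ->] fP]; apply: residual_sum => [|g]; first by case: gradP.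
have [n _] := fP g; apply: graded_prime_residual_exp => //.
by exists g.
Qed.

(** * The radical of a submodule *)

Lemma subset_module_radical N : N `<=` graded_module_radical Rg Mg N.
Proof. by move=> x Nx P [_]; apply. Qed.

Lemma graded_prime_module_radical P :
  graded_prime Rg Mg P -> graded_module_radical Rg Mg P = P.
Proof.
move=> Pprime; apply/seteqP; split; last exact: subset_module_radical.
by move=> x; apply; split.
Qed.

Lemma module_radical_submod N :
  submod_closed (mem (graded_module_radical Rg Mg N)).
Proof.
split=> [|a x y]; rewrite !in_setE.
  by move=> P [[[Psub _] _ _] _]; apply: submod_mem0.
move=> Nx Ny P PN; have [[[Psub _] _ _] _] := PN.
by apply: submod_memD (Ny P PN) => //; apply: submod_memZ (Nx P PN).
Qed.

Lemma residual_module_radical N : graded_ring Rg -> graded_module Rg Mg ->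
  graded_radical Rg (residual (graded_module_radical Rg Mg N)) `<=`
    residual (graded_module_radical Rg Mg N).
Proof.
move=> gradR gradM a aN m P PN; have [Pprime _] := PN.
suff: residual P a by apply.
rewrite -graded_prime_radical //; apply: graded_radical_mono aN.
by apply: residual_mono => x; apply.
Qed.

Lemma graded_spec_primary : graded_ring Rg -> graded_module Rg Mg ->
  graded_spec Rg Mg `<=` graded_primary_spec Rg Mg.
Proof.
move=> gradR gradM P Pprime; have [gradP P_proper Pmul] := Pprime.
split; last by rewrite graded_prime_module_radical // graded_prime_radical.
by split=> // r m; rewrite graded_prime_radical //; apply: Pmul.
Qed.

Lemma radical_subset_residual N Q : graded_ring Rg -> graded_module Rg Mg ->
  graded_submodule Mg N ->
  (graded_radical Rg (residual N) `<=`
     residual (graded_module_radical Rg Mg Q)) =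
  (residual N `<=` residual (graded_module_radical Rg Mg Q)).
Proof.
move=> gradR gradM gradN; apply/propext; split=> NQ.
  by apply: subset_trans NQ; apply: residual_subset_radical.
apply: subset_trans (residual_module_radical gradR gradM).
exact: graded_radical_mono.
Qed.

(** In this form [nuG] visibly depends on [N] only through the graded radical of its residual, which
    is the direct half of (3). *)
Lemma nuG_radical N : graded_ring Rg -> graded_module Rg Mg ->
  graded_submodule Mg N ->
  nuG Rg Mg N =
  [set Q | graded_primary_spec Rg Mg Q /\
     graded_radical Rg (residual N) `<=`
       residual (graded_module_radical Rg Mg Q)].
Proof.
move=> gradR gradM gradN; apply/seteqP.
by split=> Q [PQ NQ]; split=> //; move: NQ; rewrite radical_subset_residual.
Qed.

(** The inclusion is tested at the point [N], which lies in [nuG N]; the equation defining the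
    primary spectrum then turns [(Gr_M(N) : M)] into [Gr((N : M))]. *)
Lemma nuG_subset_radical N N' : graded_ring Rg -> graded_module Rg Mg ->
  graded_submodule Mg N' -> graded_primary_spec Rg Mg N ->
  nuG Rg Mg N `<=` nuG Rg Mg N' ->
  graded_radical Rg (residual N') `<=` graded_radical Rg (residual N).
Proof.
move=> gradR gradM gradN' PN NN'; have [[gradN _ _] <-] := PN.
rewrite radical_subset_residual //.
have: nuG Rg Mg N N.
  split=> //; apply: residual_mono; exact: subset_module_radical.
by move/NN' => [].
Qed.

Lemma nuG_star_smul I : nuG_star Rg Mg (ideal_smul M I) =
  [set Q | graded_primary_spec Rg Mg Q /\
     I `<=` residual (graded_module_radical Rg Mg Q)].
Proof.
apply/seteqP; split=> Q [PQ IQ]; split=> //; move: IQ;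
by rewrite ideal_smul_subset //; apply: module_radical_submod.
Qed.

Lemma nuG_smul I : nuG Rg Mg (ideal_smul M I) = nuG_star Rg Mg (ideal_smul M I).
Proof.
apply/seteqP; split=> Q [PQ IQ]; split=> //; last exact: residual_mono.
rewrite ideal_smul_subset; last exact: module_radical_submod.
by apply: subset_trans IQ; apply: subset_residual_smul.
Qed.

End Graded.

Theorem lemma2p6 (G : groupType) (R : comPzRingType) (M : lmodType R)
    (Rg : G -> set R) (Mg : G -> set M)
    (gradR : graded_ring Rg) (gradM : graded_module Rg Mg)
    (spec_neq0 : graded_spec Rg Mg !=set0)
    (primary_spec_neq0 : graded_primary_spec Rg Mg !=set0)
    (N N' : set M) (I : set R)
    (gradN : graded_submodule Mg N) (gradN' : graded_submodule Mg N')
    (gradI : graded_ideal Rg I) :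
  [/\ VG Rg Mg N = nuG Rg Mg N `&` graded_spec Rg Mg,
      VG_star Rg Mg N = nuG_star Rg Mg N `&` graded_spec Rg Mg,
      (graded_radical Rg (residual N) = graded_radical Rg (residual N') ->
         nuG Rg Mg N = nuG Rg Mg N') /\
      (graded_primary_spec Rg Mg N -> graded_primary_spec Rg Mg N' ->
         nuG Rg Mg N = nuG Rg Mg N' ->
         graded_radical Rg (residual N) = graded_radical Rg (residual N'))
    & [/\ nuG Rg Mg N = nuG Rg Mg (ideal_smul M (residual N)),
          nuG Rg Mg (ideal_smul M (residual N)) =
            nuG_star Rg Mg (ideal_smul M (residual N)),
          nuG_star Rg Mg (ideal_smul M (residual N)) =
            nuG_star Rg Mg (ideal_smul M (graded_radical Rg (residual N)))
        & nuG_star Rg Mg (ideal_smul M I) = nuG Rg Mg (ideal_smul M I)]].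
Proof.
(* On graded primes [Gr_M(P) = P], so the conditions defining the two kinds of variety coincide
   there, giving (1) and (2). *)
have specE P : graded_spec Rg Mg P ->
    graded_primary_spec Rg Mg P /\ graded_module_radical Rg Mg P = P.
  move=> Pprime; split; first exact: graded_spec_primary.
  exact: graded_prime_module_radical.
split.
- apply/seteqP; split=> P.
    by move=> [Pprime NP]; have [PP rP] := specE _ Pprime; rewrite -rP in NP.
  by move=> [[PP NP] Pprime]; have [_ rP] := specE _ Pprime; rewrite rP in NP.
- apply/seteqP; split=> P.
    by move=> [Pprime NP]; have [PP rP] := specE _ Pprime; rewrite -rP in NP.
  by move=> [[PP NP] Pprime]; have [_ rP] := specE _ Pprime; rewrite rP in NP.
- split=> [radE | PN PN' nuE]; first by rewrite !nuG_radical // radE.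
  apply/seteqP; split; apply: (nuG_subset_radical gradR gradM) => //;
  by rewrite nuE; apply: subset_refl.
split; last by rewrite nuG_smul.
- by rewrite /nuG residual_smul_residual //; case: gradN.
- exact: nuG_smul.
(* Both sides become conditions on an ideal inside [(Gr_M(Q) : M)]; the one on the radical folds
   into [nuG N], whose definition is the other. *)
- by rewrite !nuG_star_smul -nuG_radical.
Qed.
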